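(* Let $\mathfrak V$ be a locally finite variety of algebras over a field $\mathbf F$. The following properties are equivalent. (i) Any finite subalgebra $A$ of a finite algebra $B\in\mathfrak V$ is a retract of $B$. (ii) $\mathfrak V$ is generated by a finite set $\mathcal A$ of finite minimal algebras. (iii) Every finite algebra of $\mathfrak V$ is injective in $\mathfrak V$.
   Context: An algebra over a field $\mathbf F$ is a vector space over $\mathbf F$ with a bilinear multiplication (not assumed associative, commutative or unital). A variety of $\mathbf F$-algebras is the class of all $\mathbf F$-algebras satisfying a given set of polynomial identities $v(x_1,\dots,x_n)=0$, where each $v$ is a nonassociative polynomial over $\mathbf F$ without constant term. It is locally finite if every finitely generated algebra in it is finite. The variety generated by a set $\mathcal A$ of algebras is the class of all algebras satisfying every identity that holds in all algebras of $\mathcal A$ (for $\mathcal A=\varnothing$ it is the trivial variety consisting of the zero algebra). A nonzero algebra is minimal if it has no proper nonzero subalgebras. A subalgebra $A$ of an algebra $B$ is a retract of $B$ if there is a two-sided ideal $I$ of $B$ such that $B=A+I$ and $A\cap I=\{0\}$. An algebra $A\in\mathfrak V$ is injective in $\mathfrak V$ if it is a retract of every algebra of $\mathfrak V$ that contains it as a subalgebra. *)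

(* Defs.v *)
From HB Require Import structures.
From mathcomp Require Import all_boot all_algebra.
From mathcomp Require Import finmap monalg.
From mathcomp Require Import boolp classical_sets functions cardinality.

Set Implicit Arguments.
Unset Strict Implicit.
Unset Printing Implicit Defensive.

Import GRing.Theory.
Local Open Scope classical_set_scope.
Local Open Scope ring_scope.

Record algebra (F : fieldType) := Algebra {
  carrier :> lmodType F;
  amul : {bilinear carrier -> carrier -> carrier}
}.

(* The free magma on the variables x_0, x_1, ...; there is no unit, so that
   linear combinations of its elements have no constant term. *)
Inductive monomial := Var of nat | Mul of monomial & monomial.

Fixpoint monomial_code (m : monomial) : GenTree.tree nat :=
  match m with
  | Var i => GenTree.Leaf i
  | Mul m1 m2 => GenTree.Node 0 [:: monomial_code m1; monomial_code m2]
  end.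

Fixpoint monomial_decode (t : GenTree.tree nat) : option monomial :=
  match t with
  | GenTree.Leaf i => Some (Var i)
  | GenTree.Node _ [:: t1; t2] =>
      if monomial_decode t1 is Some m1 then
        if monomial_decode t2 is Some m2 then Some (Mul m1 m2) else None
      else None
  | _ => None
  end.

Lemma monomial_codeK : pcancel monomial_code monomial_decode.
Proof. by elim=> //= m1 -> m2 ->. Qed.

HB.instance Definition _ :=
  Countable.copy monomial (pcan_type monomial_codeK).

Section Algebras.
Variable F : fieldType.
Implicit Types A B : algebra F.

Fixpoint meval A (x : nat -> A) (m : monomial) : A :=
  match m with
  | Var i => x i
  | Mul m1 m2 => amul A (meval x m1) (meval x m2)
  end.

Definition peval A (x : nat -> A) (v : {malg F[monomial]}) : A :=
  \sum_(m <- msupp v) v@_m *: meval x m.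

Definition satisfies A (v : {malg F[monomial]}) : Prop :=
  forall x : nat -> A, peval x v = 0.

(* Classes of algebras are plain predicates rather than [set (algebra F)]:
   the latter is subject to universe constraints, [set] being universe
   monomorphic. *)
Definition is_variety (V : algebra F -> Prop) : Prop :=
  exists E : set {malg F[monomial]},
    forall A, V A <-> (forall v, E v -> satisfies A v).

Definition generated_variety (I : Type) (a : I -> algebra F) (B : algebra F)
    : Prop :=
  forall v, (forall i, satisfies (a i) v) -> satisfies B v.

Definition finite_algebra A : Prop := finite_set [set: A].

Definition subspace A (S : set A) : Prop :=
  S 0 /\ forall (c : F) (x y : A), S x -> S y -> S (c *: x + y).

Definition subalgebra A (S : set A) : Prop :=
  subspace S /\ forall x y : A, S x -> S y -> S (amul A x y).

Definition ideal A (I : set A) : Prop :=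
  subspace I /\ forall x y : A, I x -> I (amul A x y) /\ I (amul A y x).

Definition finitely_generated A : Prop :=
  exists2 X : set A, finite_set X &
    forall S : set A, subalgebra S -> X `<=` S -> S = [set: A].

Definition locally_finite (V : algebra F -> Prop) : Prop :=
  forall A, V A -> finitely_generated A -> finite_algebra A.

Definition minimal_algebra A : Prop :=
  (exists x : A, x != 0) /\
  forall S : set A, subalgebra S -> S = [set 0] \/ S = [set: A].

Definition retract B (S : set B) : Prop :=
  exists I : set B,
    [/\ ideal I,
        (forall b : B, exists s i : B, [/\ S s, I i & b = s + i])
      & S `&` I = [set 0]].

(* "B contains A as a subalgebra" is rendered by an embedding of A into B,
   identifying A with the image of the embedding. *)
Definition embedding A B (f : {linear A -> B}) : Prop :=
  injective f /\ forall x y : A, f (amul A x y) = amul B (f x) (f y).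

Definition injective_in (V : algebra F -> Prop) A : Prop :=
  V A /\
  forall B, V B -> forall f : {linear A -> B}, embedding f ->
    retract (range f).

End Algebras.

(* Main.v *)
(* (i) => (iii): a retraction ideal of a finite subalgebra A of an infinite B is
   obtained by compactness from those of A in the finite subalgebras of B.
   (i) => (ii): retracting onto minimal subalgebras separates the points of the
   finite algebras of V, so V is generated by its minimal algebras; these are
   images of the free algebra of rank 1 of V, which is finite.
   (ii) => (i): let C be an algebra and f_1, ..., f_r homomorphisms from C to
   minimal algebras. Every subalgebra S of C has an ideal I with C = S + I and
   S /\ I killed by all the f_j: start from I = C and, for each j in turn, keep I
   if f_j kills S /\ I; otherwise f_j maps S /\ I onto its codomain, by
   minimality, and I can be replaced by I /\ ker f_j. *)
Require Import Defs.
From HB Require Import structures.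
From mathcomp Require Import all_boot all_algebra.
From mathcomp Require Import finmap monalg.
From mathcomp Require Import boolp classical_sets functions cardinality filter.

Set Implicit Arguments.
Unset Strict Implicit.
Unset Printing Implicit Defensive.

Import GRing.Theory.
Local Open Scope classical_set_scope.
Local Open Scope ring_scope.
Local Open Scope quotient_scope.

(** * Linear extension of maps defined on a basis *)

Section LinearExtension.
Variables (F : fieldType) (K : choiceType) (U : lmodType F).
Implicit Types (f : K -> U) (p : {malg F[K]}).

Definition linext f p : U := \sum_(m <- msupp p) p@_m *: f m.

Lemma linextEw f p (d : {fset K}) :
  (msupp p `<=` d)%fset -> linext f p = \sum_(m <- d) p@_m *: f m.
Proof.
move=> pd; rewrite /linext (big_fset_incl _ pd) // => m _ /mcoeff_outdom ->.
by rewrite scale0r.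
Qed.

Fact linext_is_linear f : linear (linext f).
Proof.
move=> c p q; pose d := (msupp p `|` msupp q)%fset.
have pd : (msupp p `<=` d)%fset by rewrite fsubsetUl.
have qd : (msupp q `<=` d)%fset by rewrite fsubsetUr.
have pqd : (msupp (c *: p + q) `<=` d)%fset.
  apply: fsubset_trans (msuppD_le _ _) _.
  by rewrite fsubUset qd (fsubset_trans (msuppZ_le _ _) pd).
rewrite !(linextEw _ pd, linextEw _ qd, linextEw _ pqd) scaler_sumr -big_split.
by apply: eq_bigr => m _; rewrite /= mcoeffD mcoeffZ scalerDl scalerA.
Qed.

HB.instance Definition _ f :=
  GRing.isLinear.Build F {malg F[K]} U _ (linext f) (linext_is_linear f).

Lemma linextU f m : linext f << m >> = f m.
Proof. by rewrite /linext msuppU oner_eq0 big_seq_fset1 mcoeffUU scale1r. Qed.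

Lemma linext_linearl p : linear (linext^~ p).
Proof.
move=> c f g; rewrite /linext scaler_sumr -big_split; apply: eq_bigr => m _.
by rewrite /= scalerDr !scalerA mulrC.
Qed.

End LinearExtension.

Lemma linear_linext (F : fieldType) (K : choiceType) (U W : lmodType F)
    (g : {linear U -> W}) (f : K -> U) (p : {malg F[K]}) :
  g (linext f p) = linext (g \o f) p.
Proof. by rewrite linear_sum; apply: eq_bigr => m _; rewrite linearZ. Qed.

(** * The free nonassociative algebra and its evaluation homomorphisms *)

Section FreeAlgebra.
Variable F : fieldType.

(** The bilinear extension of [Mul], which makes polynomials the free algebra without unit on
    countably many generators. *)
Definition poly_mul (p q : {malg F[monomial]}) : {malg F[monomial]} :=
  linext (fun m1 => linext (fun m2 => << Mul m1 m2 >>) q) p.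

Fact poly_mul_bilinear :
  bilinear_for (GRing.Scale.Law.clone _ _ *:%R _)
    (GRing.Scale.Law.clone _ _ *:%R _) poly_mul.
Proof.
split=> [q|p] c p1 p2; rewrite /poly_mul /=; first exact: linearP.
rewrite -(linext_linearl p c).
by congr linext; apply/funext => m; exact: linearP.
Qed.

HB.instance Definition _ :=
  bilinear_isBilinear.Build F _ _ _ _ _ poly_mul poly_mul_bilinear.

Definition free_algebra : algebra F := Algebra poly_mul.

Variables (A : algebra F).
Implicit Types (x y : nat -> A) (p q : free_algebra).

HB.instance Definition _ x :=
  GRing.isLinear.Build F {malg F[monomial]} A _ (peval x)
    (linext_is_linear (meval x)).

Lemma peval_var x i : peval x << Var i >> = x i.
Proof. exact: (linextU (meval x)). Qed.

Lemma peval_mul x p q :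
  peval x (amul free_algebra p q) = amul A (peval x p) (peval x q).
Proof.
rewrite (linear_linext (peval x)).
(* Right multiplication is seen as a linear map, so that it moves inside the sum over the monomials
   of [p]. *)
rewrite -[RHS]/(applyr (amul A) (peval x q) (linext (meval x) p)).
rewrite (linear_linext (applyr (amul A) (peval x q))).
congr linext; apply/funext => m1 /=.
rewrite (linear_linext (peval x)) /applyr -[peval x q]/(linext (meval x) q).
rewrite (linear_linext (amul A (meval x m1))).
by congr linext; apply/funext => m2 /=; exact: (linextU (meval x)).
Qed.
End FreeAlgebra.

Section Homomorphisms.
Variables (F : fieldType) (A B : algebra F) (f : {linear A -> B}).
Hypothesis fM : forall x y, f (amul A x y) = amul B (f x) (f y).

Lemma hom_meval (x : nat -> A) m : f (meval x m) = meval (f \o x) m.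
Proof. by elim: m => //= m1 IH1 m2 IH2; rewrite fM IH1 IH2. Qed.

Lemma hom_peval (x : nat -> A) v : f (peval x v) = peval (f \o x) v.
Proof.
rewrite (linear_linext f); congr linext; apply/funext => m; exact: hom_meval.
Qed.
End Homomorphisms.

(** [peval x] is a homomorphism out of the free algebra, in which [peval y v] is a substitution of
    polynomials into [v]. *)
Lemma peval_peval (F : fieldType) (A : algebra F) (x : nat -> A)
    (y : nat -> free_algebra F) v :
  peval x (peval y v) = peval (peval x \o y) v.
Proof.
exact: (hom_peval (A := free_algebra F) (f := peval x)) (peval_mul x) y v.
Qed.

(** * Closure properties of subspaces, subalgebras and ideals *)

Section Subspaces.
Variables (F : fieldType) (A : algebra F) (S : set A).
Hypothesis Ssub : subspace S.

Lemma subspace0 : S 0. Proof. exact: Ssub.1. Qed.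

Lemma subspaceD x y : S x -> S y -> S (x + y).
Proof. by move=> Sx Sy; rewrite -[x]scale1r; apply: Ssub.2. Qed.

Lemma subspaceZ c x : S x -> S (c *: x).
Proof.
by move=> Sx; rewrite -[_ *: _]addr0; apply: Ssub.2 => //; exact: Ssub.1.
Qed.

Lemma subspaceB x y : S x -> S y -> S (x - y).
Proof. by move=> Sx Sy; rewrite addrC -scaleN1r; apply: Ssub.2. Qed.

End Subspaces.

Lemma ideal_subalgebra (F : fieldType) (A : algebra F) (I : set A) :
  ideal I -> subalgebra I.
Proof. by case=> Isub IM; split=> // x y Ix _; have [] := IM x y Ix. Qed.

Lemma subalgebraI (F : fieldType) (A : algebra F) (S T : set A) :
  subalgebra S -> subalgebra T -> subalgebra (S `&` T).
Proof.
move=> [[S0 SD] SM] [[T0 TD] TM]; split; first split=> //.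
  by move=> c x y [Sx Tx] [Sy Ty]; split; [apply: SD | apply: TD].
by move=> x y [Sx Tx] [Sy Ty]; split; [apply: SM | apply: TM].
Qed.

Lemma idealI (F : fieldType) (A : algebra F) (I J : set A) :
  ideal I -> ideal J -> ideal (I `&` J).
Proof.
move=> [Isub IM] [Jsub JM]; split=> [|x y [Ix Jx]].
  split=> [|c x y [Ix Jx] [Iy Jy]]; first by split; apply: subspace0.
  by split; [apply: Isub.2 | apply: Jsub.2].
by have [? ?] := IM x y Ix; have [? ?] := JM x y Jx.
Qed.

(** * Subalgebras and quotients as algebras *)

Section SubalgebraObject.
Variables (F : fieldType) (A : algebra F) (S : set A).

(** The closure proof is a parameter of the type, so that the structures built from it can be
    inferred from the type. *)
Definition subalg_carrier (Ssub : subalgebra S) := {x : A | x \in S}.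

Hypothesis Ssub : subalgebra S.
Local Notation T := (subalg_carrier Ssub).

HB.instance Definition _ := SubChoice.copy T {x : A | x \in S}.

Fact subalg_submod_closed : GRing.submod_closed (mem S).
Proof.
split=> [|c x y]; first by apply/mem_set; exact: Ssub.1.1.
by move=> /set_mem Sx /set_mem Sy; apply/mem_set; exact: Ssub.1.2.
Qed.

HB.instance Definition _ :=
  GRing.SubChoice_isSubLmodule.Build F A (mem S) T subalg_submod_closed.

Lemma subalg_valP (x : T) : S (val x).
Proof. exact: set_mem (valP x). Qed.

Definition subalg_mul (x y : T) : T :=
  Sub (amul A (val x) (val y))
    (mem_set (Ssub.2 _ _ (subalg_valP x) (subalg_valP y))).

Fact subalg_mul_bilinear :
  bilinear_for (GRing.Scale.Law.clone _ _ *:%R _)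
    (GRing.Scale.Law.clone _ _ *:%R _) subalg_mul.
Proof.
split=> z c x y; apply: val_inj; rewrite /=.
  exact: linearPl.
exact: linearPr.
Qed.

HB.instance Definition _ :=
  bilinear_isBilinear.Build F _ _ _ _ _ subalg_mul subalg_mul_bilinear.

Definition subalg : algebra F := Algebra subalg_mul.

Definition subalg_val : {linear subalg -> A} := (val : T -> A).

Lemma subalg_val_inj : injective subalg_val.
Proof. exact: val_inj. Qed.

Lemma subalg_valM x y :
  subalg_val (amul subalg x y) = amul A (subalg_val x) (subalg_val y).
Proof. by []. Qed.

Lemma subalg_valS (x : subalg) : S (subalg_val x).
Proof. exact: subalg_valP. Qed.

Lemma subalg_lift x : S x -> exists y : subalg, subalg_val y = x.
Proof. by move=> /mem_set Sx; exists (Sub x Sx : T). Qed.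

End SubalgebraObject.

Section QuotientObject.
Variables (F : fieldType) (A : algebra F) (I : set A).

Definition quot_pred (Iideal : ideal I) : {pred A} := fun x => x \in I.

Hypothesis Iideal : ideal I.
Local Notation P := (quot_pred Iideal).

Fact quot_zmod_closed : GRing.zmod_closed P.
Proof.
split=> [|x y]; first by apply/mem_set; exact: subspace0 Iideal.1.
move=> /set_mem Ix /set_mem Iy; apply/mem_set.
exact: subspaceB Iideal.1 _ _ Ix Iy.
Qed.

HB.instance Definition _ := GRing.isZmodClosed.Build A P quot_zmod_closed.

Definition quot_carrier := Quotient.quot P.
Local Notation Q := quot_carrier.

HB.instance Definition _ := GRing.Zmodule.on Q.

Definition quot_pi (x : A) : Q := \pi_Q x.

Lemma quot_piE x y : quot_pi x = quot_pi y <-> I (x - y).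
Proof.
split=> [/eqP|Ixy]; first by rewrite -Quotient.idealrBE => /set_mem.
by apply/eqP; rewrite -Quotient.idealrBE; apply/mem_set.
Qed.

Lemma quot_pi_surj (q : Q) : exists x, q = quot_pi x.
Proof. by exists (repr q); rewrite /quot_pi reprK. Qed.

Lemma quot_reprP x : I (repr (quot_pi x) - x).
Proof. by apply/quot_piE; rewrite /quot_pi reprK. Qed.

Lemma quot_piD x y : quot_pi (x + y) = quot_pi x + quot_pi y.
Proof. exact: raddfD. Qed.

(** Independence from the representative is [quot_scaleE], and comes from [I] being closed under
    scaling. *)
Definition quot_scale (c : F) (q : Q) : Q := quot_pi (c *: repr q).

Lemma quot_scaleE c x : quot_scale c (quot_pi x) = quot_pi (c *: x).
Proof.
apply/quot_piE; rewrite -scalerBr; apply: subspaceZ Iideal.1 _ _ _.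
exact: quot_reprP.
Qed.

Fact quot_scaleA a b q : quot_scale a (quot_scale b q) = quot_scale (a * b) q.
Proof.
by have [x ->] := quot_pi_surj q; rewrite !quot_scaleE scalerA.
Qed.

Fact quot_scale1 : left_id 1 quot_scale.
Proof.
by move=> q; have [x ->] := quot_pi_surj q; rewrite quot_scaleE scale1r.
Qed.

Fact quot_scaleDr : right_distributive quot_scale +%R.
Proof.
move=> c p q; have [x ->] := quot_pi_surj p; have [y ->] := quot_pi_surj q.
by rewrite -quot_piD !quot_scaleE scalerDr quot_piD.
Qed.

Fact quot_scaleDl q : {morph quot_scale^~ q : a b / a + b}.
Proof.
move=> a b; have [x ->] := quot_pi_surj q.
by rewrite !quot_scaleE scalerDl quot_piD.
Qed.

HB.instance Definition _ :=
  GRing.Zmodule_isLmodule.Build F Q quot_scaleA quot_scale1 quot_scaleDr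
    quot_scaleDl.

Fact quot_pi_is_linear : linear quot_pi.
Proof. by move=> c x y; rewrite quot_piD -quot_scaleE. Qed.

HB.instance Definition _ :=
  GRing.isLinear.Build F A Q _ quot_pi quot_pi_is_linear.

Definition quot_mul (p q : Q) : Q := quot_pi (amul A (repr p) (repr q)).

Lemma quot_mulE x y : quot_mul (quot_pi x) (quot_pi y) = quot_pi (amul A x y).
Proof.
apply/quot_piE; set x' := repr _; set y' := repr _.
have -> : amul A x' y' - amul A x y = amul A (x' - x) y' + amul A x (y' - y).
  by rewrite linearBl linearBr addrA subrK.
apply: subspaceD Iideal.1 _ _ _ _.
  by have [] := Iideal.2 _ y' (quot_reprP x).
by have [] := Iideal.2 _ x (quot_reprP y).
Qed.

Fact quot_mul_bilinear :
  bilinear_for (GRing.Scale.Law.clone _ _ *:%R _)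
    (GRing.Scale.Law.clone _ _ *:%R _) quot_mul.
Proof.
split=> r c p q /=; have [x ->] := quot_pi_surj p;
  have [y ->] := quot_pi_surj q; have [z ->] := quot_pi_surj r.
  by rewrite -linearP !quot_mulE linearPl linearP.
by rewrite -linearP !quot_mulE linearPr linearP.
Qed.

HB.instance Definition _ :=
  bilinear_isBilinear.Build F _ _ _ _ _ quot_mul quot_mul_bilinear.

Definition quot_algebra : algebra F := Algebra quot_mul.

Definition quot_proj : {linear A -> quot_algebra} := quot_pi.

Lemma quot_projM x y :
  quot_proj (amul A x y) = amul quot_algebra (quot_proj x) (quot_proj y).
Proof. exact/esym/quot_mulE. Qed.

Lemma quot_projE x y : quot_proj x = quot_proj y <-> I (x - y).
Proof. exact: quot_piE. Qed.

Lemma quot_proj_surj (q : quot_algebra) : exists x, quot_proj x = q.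
Proof. by have [x ->] := quot_pi_surj q; exists x. Qed.

End QuotientObject.

(** * Images and preimages under homomorphisms *)

Section HomomorphicImages.
Variables (F : fieldType) (A B : algebra F) (f : {linear A -> B}).
Hypothesis fM : forall x y, f (amul A x y) = amul B (f x) (f y).

Lemma subalgebra_image (S : set A) : subalgebra S -> subalgebra (f @` S).
Proof.
move=> [Ssub SM]; split; first split.
- by exists 0; rewrite ?linear0 //; exact: subspace0.
- move=> c _ _ [x Sx <-] [y Sy <-]; exists (c *: x + y); rewrite ?linearP //.
  exact: Ssub.2.
- move=> _ _ [x Sx <-] [y Sy <-]; exists (amul A x y); first exact: SM.
  exact: fM.
Qed.

Lemma subalgebra_preimage (S : set B) : subalgebra S -> subalgebra (f @^-1` S).
Proof.
move=> [Ssub SM]; split; first split=> /=.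
- by rewrite linear0; exact: subspace0.
- by move=> c x y Sx Sy; rewrite /= linearP; apply: Ssub.2.
- by move=> x y Sx Sy; rewrite /= fM; apply: SM.
Qed.

Lemma ideal_image (I : set A) :
  set_surj setT setT f -> ideal I -> ideal (f @` I).
Proof.
move=> fsurj Iideal; split.
  exact: (subalgebra_image (ideal_subalgebra Iideal)).1.
move=> _ b [x Ix <-]; have [y _ <-] := fsurj b Logic.I.
have [Ixy Iyx] := Iideal.2 x y Ix.
by split; [exists (amul A x y) | exists (amul A y x)]; rewrite ?fM.
Qed.

Lemma ideal_preimage (I : set B) : ideal I -> ideal (f @^-1` I).
Proof.
move=> Iideal; split.
  exact: (subalgebra_preimage (ideal_subalgebra Iideal)).1.
by move=> x y Ix; rewrite /= !fM; exact: Iideal.2.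
Qed.

End HomomorphicImages.

Lemma ideal_set0 (F : fieldType) (A : algebra F) : ideal [set (0 : A)].
Proof.
split=> [|x y ->]; last by rewrite linear0l linear0r.
by split=> // c x y -> ->; rewrite scaler0 addr0.
Qed.

Lemma subalgebra_range_peval (F : fieldType) (A : algebra F) (x : nat -> A) :
  subalgebra (range (peval x : free_algebra F -> A)).
Proof.
exact: (subalgebra_image (A := free_algebra F) (f := peval x) (peval_mul x)).
Qed.

(** * Generated subalgebras *)

Section GeneratedSubalgebra.
Variables (F : fieldType) (A : algebra F) (X : set A).

Definition generated : set A :=
  [set a | forall S : set A, subalgebra S -> X `<=` S -> S a].

Lemma generated_subalgebra : subalgebra generated.
Proof.
split; first split.
- by move=> S [[]].
- move=> c x y Gx Gy S Ssub XS; apply: Ssub.1.2; [exact: Gx | exact: Gy].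
- move=> x y Gx Gy S Ssub XS; apply: Ssub.2; [exact: Gx | exact: Gy].
Qed.

Lemma sub_generated : X `<=` generated.
Proof. by move=> x Xx S _; apply. Qed.

(** A subalgebra containing the generators has an image in [A] that contains [X], hence all of
    [generated X]. *)
Lemma generated_fg :
  finite_set X -> finitely_generated (subalg generated_subalgebra).
Proof.
set f := subalg_val generated_subalgebra => Xfin.
exists (f @^-1` X).
  apply: finite_preimage Xfin => x y _ _; exact: subalg_val_inj.
move=> S Ssub XS; apply/seteqP; split=> // y _.
have [z Sz /subalg_val_inj <- //] : (f @` S) (f y).
apply: (subalg_valS y).
  exact: (subalgebra_image (f := f) (@subalg_valM _ _ _ _) Ssub).
move=> x Xx; have [z fz] := subalg_lift generated_subalgebra (sub_generated Xx).
by exists z => //; apply: XS => /=; rewrite -fz in Xx.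
Qed.

End GeneratedSubalgebra.

(** Only finitely many variables occur in [v]; the bound is uniform over all algebras. *)
Lemma peval_eq_bounded (F : fieldType) (v : {malg F[monomial]}) :
  exists N, forall (A : algebra F) (x y : nat -> A),
    (forall i, (i < N)%N -> x i = y i) -> peval x v = peval y v.
Proof.
have bm (m : monomial) : exists N, forall (A : algebra F) (x y : nat -> A),
    (forall i, (i < N)%N -> x i = y i) -> meval x m = meval y m.
  elim: m => [i|m1 [N1 IH1] m2 [N2 IH2]]; first by exists i.+1 => A x y; apply.
  exists (maxn N1 N2) => A x y xy /=; congr (amul A _ _).
    by apply: IH1 => i lti; apply: xy; rewrite leq_max lti.
  by apply: IH2 => i lti; apply: xy; rewrite leq_max lti orbT.
have [N bN] := choice bm; exists (\max_(m <- msupp v) N m)%N => A x y xy.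
apply: eq_big_seq => m mv; congr (_ *: _); apply: bN => i lti; apply: xy.
exact: leq_trans lti (leq_bigmax_seq _ mv _).
Qed.

(** * Closure of varieties under subalgebras *)

Section Varieties.
Variables (F : fieldType) (V : algebra F -> Prop).
Hypothesis V_variety : is_variety V.

Lemma satisfies_embedding (A B : algebra F) (f : {linear A -> B}) v :
  embedding f -> satisfies B v -> satisfies A v.
Proof.
move=> [finj fM] Bv x; apply: finj; rewrite (hom_peval fM) linear0; exact: Bv.
Qed.

Lemma variety_embedding (A B : algebra F) (f : {linear A -> B}) :
  embedding f -> V B -> V A.
Proof.
case: V_variety => E VE femb /VE BE; apply/VE => v /BE.
exact: satisfies_embedding femb.
Qed.

Lemma subalg_embedding (A : algebra F) (S : set A) (Ssub : subalgebra S) :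
  embedding (subalg_val Ssub).
Proof. by split; [exact: subalg_val_inj | exact: subalg_valM]. Qed.

Lemma variety_subalg (A : algebra F) (S : set A) (Ssub : subalgebra S) :
  V A -> V (subalg Ssub).
Proof. exact/variety_embedding/subalg_embedding. Qed.

End Varieties.

Lemma subalg_finite (F : fieldType) (A : algebra F) (S : set A)
    (Ssub : subalgebra S) :
  finite_algebra (subalg Ssub) <-> finite_set S.
Proof.
split=> [fin|Sfin].
  apply: sub_finite_set (finite_image (subalg_val Ssub) fin) => x Sx.
  by have [y yx] := subalg_lift Ssub Sx; exists y.
apply: sub_finite_set (finite_preimage (f := subalg_val Ssub) _ Sfin).
  by move=> x _; exact: subalg_valS.
move=> x y _ _; exact: subalg_val_inj.
Qed.

Definition retract_property (F : fieldType) (V : algebra F -> Prop) : Prop :=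
  forall B : algebra F, V B -> finite_algebra B ->
    forall A : set B, subalgebra A -> finite_set A -> retract A.

(** * Retracts of finite algebras versus injectivity, by compactness *)

Section Injectivity.
Variables (F : fieldType) (V : algebra F -> Prop).
Hypotheses (V_variety : is_variety V) (V_locally_finite : locally_finite V).

(** All uses of local finiteness pass through this lemma. *)
Lemma generated_finite (B : algebra F) (X : set B) :
  V B -> finite_set X -> finite_set (generated X).
Proof.
move=> VB Xfin; apply/(subalg_finite (generated_subalgebra X)).
apply: V_locally_finite; first exact: variety_subalg.
exact: generated_fg.
Qed.

(** [I] is the image in [B] of a retraction ideal of [A] in the finite subalgebra generated by [A]
    and [X]. It need not be an ideal of [B], so absorption and decomposition are claimed for
    elements of [X] only. *)
Lemma local_retraction (B : algebra F) (A : set B) :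
    retract_property V -> V B -> subalgebra A -> finite_set A ->
  forall X : seq B, exists I : set B,
    [/\ subspace I,
        forall c x, c \in X -> I x -> I (amul B x c) /\ I (amul B c x),
        forall b, b \in X -> exists2 a, A a & I (b - a)
      & forall a, A a -> I a -> a = 0].
Proof.
move=> Vretract VB Asub Afin X; pose Y := A `|` [set` X].
pose Gsub := generated_subalgebra Y; set f := subalg_val Gsub.
have AG a : A a -> generated Y a by move=> Aa; apply: sub_generated; left.
have XG c : c \in X -> generated Y c by move=> Xc; apply: sub_generated; right.
have Gfin : finite_set (generated Y).
  by apply: generated_finite; rewrite // finite_setU; split.
have [I [Iideal GAI AI0]] : retract (f @^-1` A).
  apply: Vretract; [exact: variety_subalg | exact/subalg_finite | | ].
    exact: (subalgebra_preimage (f := f) (@subalg_valM _ _ _ _)).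
  by apply: finite_preimage Afin => x y _ _; exact: subalg_val_inj.
exists (f @` I); split.
- exact: (subalgebra_image (f := f) (@subalg_valM _ _ _ _)
           (ideal_subalgebra Iideal)).1.
- move=> c _ /XG /(subalg_lift Gsub)[d <-] [x Ix <-].
  have [Ixd Idx] := Iideal.2 x d Ix.
  by split; [exists (amul _ x d) | exists (amul _ d x)].
- move=> b /XG /(subalg_lift Gsub)[d <-].
  have [s [i [As Ii ->]]] := GAI d; exists (f s) => //; exists i => //.
  by rewrite linearD addrC addKr.
- move=> a Aa [x Ix xa].
  have : (f @^-1` A `&` I) x by split; rewrite // -xa in Aa.
  by rewrite AI0 => x0; rewrite -xa x0 linear0.
Qed.

(* A retraction ideal of [A] in [B] is an ultraproduct, along the finite subsets
   [X] of [B], of the retraction ideals of [A] in the finite subalgebras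
   generated by [A] and [X]. *)
Lemma finite_subalgebra_retract (B : algebra F) (A : set B) :
  retract_property V -> V B -> subalgebra A -> finite_set A -> retract A.
Proof.
move=> Vretract VB Asub Afin.
have /choice[J JP] := local_retraction Vretract VB Asub Afin.
pose above (X0 : seq B) := [set X : seq B | {subset X0 <= X}].
have [|U [Uultra aboveU]] := ultraFilterLemma (F := filter_from setT above).
  apply: filter_from_proper => [|X _]; last by exists X => x.
  apply: filter_fromT_filter => [|X Y]; first by exists [::].
  exists (X ++ Y) => Z XYZ; split=> x xin; apply: XYZ; rewrite mem_cat xin //.
  exact: orbT.
(* Each fixed [b] lies in [U]-almost every [X], so what holds for elements of [X] passes to all of
   [B]. *)
have Uabove b : U [set X | b \in X].
  by apply: aboveU; exists [:: b] => // X /(_ b); apply; rewrite mem_head.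
exists [set b | U [set X | J X b]]; split; first split; first split.
- by apply: filterS filterT => X _ /=; have [/subspace0] := JP X.
- move=> c x y; apply: filterS2 => X Jx Jy; have [[_ JD] _ _ _] := JP X.
  exact: JD.
- move=> x y Jx; split; apply: filterS2 Jx (Uabove y) => X Jx Xy;
  by have [_ JM _ _] := JP X; have [] := JM y x Xy Jx.
- move=> b; apply: contrapT => nAI.
  (* If no [a] in [A] worked for [b], then for each [a] almost every [J X] would miss [b - a]. As
     [A] is finite, almost every [J X] would miss all of them, against the decomposition of [b]
     available once [b] is in [X]. *)
  have /finite_seqP[s As] := Afin.
  have nU :
      U (\bigcap_(a in [set` [fset a in s]%fset]) [set X | ~ J X (b - a)]).
    apply: filter_bigI => a; rewrite inE /= => sa.
    have [Ja|//] := in_ultra_setVsetC [set X | J X (b - a)] Uultra.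
    case: nAI; exists a, (b - a); split=> //; first by rewrite As.
    by rewrite addrC subrK.
  suff: U set0 by exact: filter_not_empty.
  apply: filterS2 nU (Uabove b) => X nJ Xb; have [_ _ JS _] := JP X.
  have [a Aa Jba] := JS b Xb; apply: nJ Jba => /=.
  by rewrite inE /=; move: Aa; rewrite As.
- apply/seteqP; split=> [a [Aa Ja]|_ ->].
    have [X JXa] := filter_ex Ja; have [_ _ _ JA] := JP X; exact: JA.
  split; first exact: subspace0 Asub.1.
  by apply: filterS filterT => X _ /=; have [/subspace0] := JP X.
Qed.

Lemma retract_property_injective :
  retract_property V ->
  forall A : algebra F, V A -> finite_algebra A -> injective_in V A.
Proof.
move=> Vretract A VA Afin; split=> // B VB f [finj fM].
apply: finite_subalgebra_retract => //; last exact: finite_image.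
by apply: subalgebra_image.
Qed.

Lemma injective_retract_property :
  (forall A : algebra F, V A -> finite_algebra A -> injective_in V A) ->
  retract_property V.
Proof.
move=> Vinj B VB Bfin A Asub Afin.
have [||_ /(_ B VB (subalg_val Asub) (subalg_embedding Asub))] :=
  Vinj (subalg Asub).
- exact: variety_subalg.
- exact/subalg_finite.
suff -> : range (subalg_val Asub) = A by [].
apply/seteqP; split=> [_ [x _ <-]|x Ax]; first exact: subalg_valS.
by have [y yx] := subalg_lift Asub Ax; exists y.
Qed.
End Injectivity.

(** * Complements modulo kernels of maps to minimal algebras *)

Section Complements.
Variables (F : fieldType) (C : algebra F).
Implicit Types (N S I : set C).

(** Retraction with an error: for [N = [set 0]] every subalgebra is a retract. The error starts as
    the whole algebra and shrinks one kernel at a time. *)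
Definition complemented_modulo N := forall S, subalgebra S -> exists I,
  [/\ ideal I, (forall c, exists s i, [/\ S s, I i & c = s + i])
    & S `&` I `<=` N].

Lemma complemented_moduloS N N' :
  N `<=` N' -> complemented_modulo N -> complemented_modulo N'.
Proof.
move=> NN' Ncomp S /Ncomp[I [Iideal SI SIN]]; exists I; split=> //.
exact: subset_trans SIN NN'.
Qed.

Lemma complemented_setT : complemented_modulo [set: C].
Proof.
move=> S Ssub; exists [set: C]; split=> // c; exists 0, c.
by split; rewrite ?add0r //; exact: subspace0 Ssub.1.
Qed.

(* If [S `&` I] is not already killed by [f], then [f] maps it onto the whole
   of [M], so [I] can be cut down to the kernel of [f]. *)
Lemma complemented_kernel (M : algebra F) (f : {linear C -> M}) N :
    (forall x y, f (amul C x y) = amul M (f x) (f y)) -> minimal_algebra M ->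
  complemented_modulo N -> complemented_modulo (N `&` [set c | f c = 0]).
Proof.
move=> fM [_ Mmin] Ncomp S Ssub; have [I [Iideal SI SIN]] := Ncomp S Ssub.
have SIsub := subalgebraI Ssub (ideal_subalgebra Iideal).
have [f0|fT] := Mmin _ (subalgebra_image fM SIsub).
  exists I; split=> // c [Sc Ic]; split; first exact: SIN.
  suff: [set (0 : M)] (f c) by [].
  by rewrite -f0; exists c.
exists (I `&` [set c | f c = 0]); split.
- by apply: idealI => //; exact: (ideal_preimage fM (ideal_set0 M)).
- move=> c; have [s [i [Ss Ii ->]]] := SI c.
  (* [t] has the same value as [i] under [f]; moving it to the summand in [S] leaves [i - t] in the
     kernel. *)
  have [t [St It] ft] : (f @` (S `&` I)) (f i) by rewrite fT.
  exists (s + t), (i - t); split; last by rewrite addrACA subrr addr0 //.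
  + exact: subspaceD Ssub.1 _ _ Ss St.
  + split; first exact: subspaceB Iideal.1 _ _ Ii It.
    by rewrite /= linearB ft subrr.
- by move=> c [Sc [Ic fc]]; split=> //; exact: SIN.
Qed.

End Complements.

(** One application of [complemented_kernel] per evaluation: the outer induction runs over the
    algebras, the inner one over the assignments listed for each. *)
Lemma complemented_peval (F : fieldType) (T : eqType) (M : T -> algebra F)
    (W : forall t, seq (nat -> M t)) (r : seq T) :
    (forall t, minimal_algebra (M t)) ->
  complemented_modulo
    [set p : free_algebra F |
      forall t, t \in r -> forall y, y \in W t -> peval y p = 0].
Proof.
move=> Mmin; elim: r => [|t r IHr].
  by apply: complemented_moduloS (@complemented_setT _ _).
have step (s : seq (nat -> M t)) : complemented_modulo
    ([set p : free_algebra F |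
       forall t', t' \in r -> forall y, y \in W t' -> peval y p = 0]
     `&` [set p | forall y, y \in s -> peval y p = 0]).
  elim: s => [|y s IHs].
    by apply: complemented_moduloS IHr.
  apply: complemented_moduloS (complemented_kernel (C := free_algebra F)
    (f := peval y) (peval_mul y) (Mmin t) IHs) => p [[rp sp] yp]; split=> // z.
  by rewrite inE => /predU1P[-> //|]; exact: sp.
apply: complemented_moduloS (step (W t)) => p [rp tp] t'.
by rewrite inE => /predU1P[-> //|]; exact: rp.
Qed.

Lemma finite_bounded_support (F : fieldType) (A : algebra F) m :
  finite_algebra A ->
  finite_set [set y : nat -> A | forall i, (m <= i)%N -> y i = 0].
Proof.
move=> Afin; elim: m => [|m IHm].
  apply: sub_finite_set (finite_set1 (fun=> 0)) => y y0.
  by apply/funext => i; exact: y0.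
pose extend (y : nat -> A) a := fun i => if i == m then a else y i.
apply: sub_finite_set (finite_image2 extend IHm Afin) => y y0.
(* Erasing the value at [m] gives an assignment covered by [IHm]; [extend] restores the value. *)
exists (fun i => if i == m then 0 else y i).
  move=> i /=; case: eqP => // /eqP im mi; apply: y0.
  by rewrite ltn_neqAle eq_sym im.
exists (y m) => //; apply/funext => i; rewrite /extend.
by case: eqP => [->|].
Qed.

(* [B] is a quotient of the free algebra by a kernel [K] containing the
   intersection [N] of the kernels of finitely many evaluations in minimal
   algebras; a complement [I] of [K] then plays the role of [B], and a complement
   modulo [N] of the preimage of [A] in [I] yields the retraction ideal. *)
Lemma generated_retract (F : fieldType) n (a : 'I_n -> algebra F)
    (B : algebra F) (A : set B) :
    (forall k, finite_algebra (a k) /\ minimal_algebra (a k)) ->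
    generated_variety a B -> finite_algebra B -> subalgebra A ->
  retract A.
Proof.
move=> afm aB Bfin Asub; have /finite_seqP[bs bsT] := Bfin.
(* The default 0 makes [b] an enumeration of [B] supported on the first [m] variables. *)
pose m := size bs; pose b i := nth 0 bs i.
have b0 i : (m <= i)%N -> b i = 0 by exact: nth_default.
have bsurj x : exists i, b i = x.
  have /(nthP 0)[i _ <-] : [set` bs] x by rewrite -bsT.
  by exists i.
pose phi : {linear free_algebra F -> B} := peval b.
have phiM : forall p q, phi (amul _ p q) = amul B (phi p) (phi q).
  exact: peval_mul.
have phi_surj : set_surj setT setT phi.
  move=> x _; have [i <-] := bsurj x.
  by exists << Var i >>; rewrite //= peval_var.
have WP k : {W : seq (nat -> a k) |
    [set` W] = [set y | forall i, (m <= i)%N -> y i = 0]}.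
  have /finite_seqP W := finite_bounded_support m (afm k).1.
  by apply: cid; case: W => W ->; exists W.
pose N := [set p : free_algebra F |
  forall k, k \in enum 'I_n -> forall y, y \in sval (WP k) -> peval y p = 0].
have Ncomp : complemented_modulo N.
  by apply: complemented_peval => k; case: (afm k).
have Nphi p : N p -> phi p = 0.
  (* [N] tests only assignments supported below [m]. The substitution [c] kills the other variables,
     so [peval c p] is an identity of every [a k], hence of [B]; its value at [b] is still that of
     [p]. *)
  pose c i : free_algebra F := if (i < m)%N then << Var i >> else 0.
  have cE (A' : algebra F) (y : nat -> A') :
      peval y (peval c p) = peval (fun i => if (i < m)%N then y i else 0) p.
    rewrite peval_peval; congr (peval _ p); apply/funext => i /=.
    by rewrite /c; case: ifP; rewrite ?peval_var ?linear0.
  move=> Np; have := aB (peval c p) _ b; rewrite cE => cp.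
  rewrite -[RHS]cp => [|k y].
    congr (peval _ p); apply/funext => i; case: ltnP => // mi; exact: b0.
  rewrite cE; apply: (Np k); first by rewrite mem_enum.
  set y' := (y' in y' \in _); suff : [set` sval (WP k)] y' by [].
  by rewrite (svalP (WP k)) => i /= mi; rewrite /y' ltnNge mi.
have phi_sub S : subalgebra S -> subalgebra (phi @^-1` S).
  exact: subalgebra_preimage.
have [I [Iideal KI KIN]] :=
  Ncomp _ (phi_sub _ (ideal_subalgebra (ideal_set0 B))).
have AIsub := subalgebraI (phi_sub A Asub) (ideal_subalgebra Iideal).
have [J [Jideal SJ SJN]] := Ncomp _ AIsub.
exists (phi @` (I `&` J)); split.
- exact/(ideal_image phiM phi_surj)/idealI.
- move=> x; have [p _ <-] := phi_surj x Logic.I.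
  have [k [i [/= k0 Ii ->]]] := KI p.
  have [s [j [[As Is] Jj ij]]] := SJ i.
  exists (phi s), (phi j); split=> //.
    exists j => //; split=> //.
    have -> : j = i - s by rewrite ij addrC addKr.
    exact: subspaceB Iideal.1 _ _ Ii Is.
  by rewrite linearD [phi k]k0 add0r ij linearD.
(* If [phi p] is in [A] with [p] in [I] and [J], then [p] is in [N], hence in the kernel of
   [phi]. *)
- apply/seteqP; split=> [x [Ax [p [Ip Jp] px]]|_ ->].
    by rewrite -px in Ax *; apply/Nphi/SJN.
  split; first exact: subspace0 Asub.1.
  exists 0; rewrite ?linear0 //; split; first exact: subspace0 Iideal.1.
  exact: subspace0 Jideal.1.
Qed.

(** * Minimal subalgebras of finite algebras *)

Lemma exists_minimal_subalgebra (F : fieldType) (B : algebra F) (S : set B) :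
    subalgebra S -> finite_set S -> (exists2 x, S x & x != 0) ->
  exists T (Tsub : subalgebra T), T `<=` S /\ minimal_algebra (subalg Tsub).
Proof.
have [n] := ubnP #|` fset_set S|; elim: n S => // n IHn S ltSn Ssub Sfin Snz.
have [[T [Tsub TS Tnz TnS]]|Smin] := pselect (exists T,
    [/\ subalgebra T, T `<=` S, exists2 x, T x & x != 0 & T <> S]).
  have Tfin := sub_finite_set TS Sfin.
  have ltTS : (#|` fset_set T| < #|` fset_set S|)%N.
    apply: fproper_ltn_card; rewrite fproperEneq; apply/andP; split.
      by apply/eqP => /(fset_set_inj Tfin Sfin).
    by rewrite -fset_set_sub.
  have [T' [T'sub [T'T T'min]]] := IHn T (leq_trans ltTS ltSn) Tsub Tfin Tnz.
  by exists T', T'sub; split=> //; exact: subset_trans TS.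
exists S, Ssub; split=> //; split.
  have [x Sx xnz] := Snz; have [y yx] := subalg_lift Ssub Sx.
  by exists y; apply: contra_neq xnz => y0; rewrite -yx y0 linear0.
move=> T Tsub; set f := subalg_val Ssub.
have [T0|Tn0] := pselect (T = [set 0]); [by left | right].
have fTsub : subalgebra (f @` T).
  exact: (subalgebra_image (f := f) (@subalg_valM _ _ _ _)).
(* A proper nonzero [T] would have as image in [B] a proper nonzero subalgebra of [S], excluded by
   [Smin]. *)
apply/seteqP; split=> // y _; apply: contrapT => nTy.
case: Smin; exists (f @` T); split=> //.
- by move=> _ [x _ <-]; exact: subalg_valS.
- apply: contrapT => T0; apply: Tn0; apply/seteqP; split=> [x Tx|_ ->].
    apply/eqP/negP => /negP xn0; apply: T0; exists (f x); first by exists x.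
    apply: contra_neq xn0 => fx0; apply: subalg_val_inj.
    by rewrite -/f fx0 linear0.
  exact: subspace0 Tsub.1.
- move=> /seteqP[_ /(_ _ (subalg_valS y))].
  by move=> -[x Tx /subalg_val_inj xy]; apply: nTy; rewrite -xy.
Qed.

Lemma subalgebra_peval (F : fieldType) (A : algebra F) (S : set A)
    (x : nat -> A) v :
  subalgebra S -> (forall i, S (x i)) -> S (peval x v).
Proof.
move=> Ssub Sx.
have /choice[y yx] i := subalg_lift Ssub (Sx i).
have -> : x = subalg_val Ssub \o y by apply/funext => i; exact/esym/yx.
rewrite -(hom_peval (f := subalg_val Ssub) (@subalg_valM _ _ _ _)).
exact: subalg_valS.
Qed.

(** * Generation of the variety by finitely many minimal algebras *)

Section MinimalGeneration.
Variables (F : fieldType) (V : algebra F -> Prop).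
Hypotheses (V_variety : is_variety V) (V_locally_finite : locally_finite V).

(** A value of [v] depends on finitely many entries of the assignment, and these generate a finite
    subalgebra. *)
Lemma finite_identity (v : {malg F[monomial]}) :
    (forall B, V B -> finite_algebra B -> satisfies B v) ->
  forall B, V B -> satisfies B v.
Proof.
move=> finv B VB x; have [N bN] := peval_eq_bounded v.
(* The entries from [N] on become 0, so that the whole assignment lies in the generated
   subalgebra. *)
pose x' i := if (i < N)%N then x i else 0.
rewrite (bN B x x') => [|i ltiN]; last by rewrite /x' ltiN.
have Xfin : finite_set (x @` `I_N) by exact/finite_image/finite_II.
have Gsub := generated_subalgebra (x @` `I_N).
have /choice[y yx] i : exists y, subalg_val Gsub y = x' i.
  apply: subalg_lift; rewrite /x'; case: ifP => [ltiN|_].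
    by apply: sub_generated; exists i.
  exact: subspace0 Gsub.1.
have -> : x' = subalg_val Gsub \o y by apply/funext => i; exact/esym/yx.
rewrite -(hom_peval (f := subalg_val Gsub) (@subalg_valM _ _ _ _)).
rewrite finv ?linear0 //.
  exact: variety_subalg.
apply/subalg_finite.
exact: generated_finite V_variety V_locally_finite _ _ VB Xfin.
Qed.

(* If [y] is a nonzero value of [v] on [B], a minimal subalgebra [T] of the
   subalgebra generated by [y] has a complementary ideal [I], which cannot
   contain [y]; so [v] fails in the algebra [T], isomorphic to [B / I]. *)
Lemma minimal_identity (v : {malg F[monomial]}) :
    retract_property V ->
    (forall M, V M -> minimal_algebra M -> satisfies M v) ->
  forall B, V B -> satisfies B v.
Proof.
move=> Vretract minv; apply: finite_identity => B VB Bfin x.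
apply/eqP/negP => /negP; set y := peval x v => yn0.
have [||T [Tsub [Ty Tmin]]] :=
  exists_minimal_subalgebra (generated_subalgebra [set y]).
- exact: sub_finite_set Bfin.
- by exists y => //; exact: sub_generated.
have [I [Iideal TI TI0]] : retract T.
  by apply: Vretract => //; exact: sub_finite_set Bfin.
(* Modulo [I] each [x i] agrees with an element of [T], so the class of [y] comes from a value of
   [v] on [T], which is 0. *)
have Iy : I y.
  rewrite -[y]subr0; apply/(quot_projE Iideal).
  rewrite linear0 (hom_peval (quot_projM Iideal)).
  have /choice[s sP] i : exists s : subalg Tsub,
      quot_proj Iideal (x i) = quot_proj Iideal (subalg_val Tsub s).
    have [t [j [Tt Ij xij]]] := TI (x i); have [s st] := subalg_lift Tsub Tt.
    by exists s; apply/quot_projE; rewrite st xij addrC addKr.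
  have -> : quot_proj Iideal \o x = quot_proj Iideal \o (subalg_val Tsub \o s).
    by apply/funext => i /=; exact: sP.
  rewrite -(hom_peval (quot_projM Iideal)).
  rewrite -(hom_peval (f := subalg_val Tsub) (@subalg_valM _ _ _ _)).
  by rewrite minv ?linear0 //; exact: variety_subalg.
(* Containing [y], the ideal [I] contains the subalgebra generated by [y], hence [T], which it meets
   only in 0. *)
have [[t tn0] _] := Tmin; move/eqP: tn0; apply.
apply: subalg_val_inj; rewrite linear0.
suff : (T `&` I) (subalg_val Tsub t) by rewrite TI0.
split; first exact: subalg_valS.
apply: (Ty _ (subalg_valS t)); first exact: ideal_subalgebra.
by move=> _ ->.
Qed.

Lemma finite_range_peval (A : algebra F) (a : A) :
  V A -> finite_set (range (peval (fun=> a) : free_algebra F -> A)).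
Proof.
move=> VA; apply: sub_finite_set (generated_finite V_variety V_locally_finite VA
  (finite_set1 a)) => _ [p _ <-].
apply: subalgebra_peval => [|_]; last exact: sub_generated.
exact: generated_subalgebra.
Qed.

(** The range is a subalgebra containing [a], the value of the variables, so it is not zero. *)
Lemma minimal_range_peval (A : algebra F) (a : A) :
  minimal_algebra A -> a != 0 ->
  range (peval (fun=> a) : free_algebra F -> A) = setT.
Proof.
move=> [_ Amin] an0; have Ra : range (peval (fun=> a) : free_algebra F -> A) a.
  by exists << Var 0 >> => //; rewrite peval_var.
have [R0|//] := Amin _ (subalgebra_range_peval (fun=> a)).
by move: Ra an0; rewrite R0 => ->; rewrite eqxx.
Qed.

(** Constant assignments identify all the variables, so the quotient by this ideal is the free
    algebra of rank 1 of [V]. *)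
Definition one_variable_identities : set (free_algebra F) :=
  [set p | forall A, V A -> forall a : A, peval (fun=> a) p = 0].

Lemma one_variable_ideal : ideal one_variable_identities.
Proof.
split; first split=> [A VA a|c p q Tp Tq A VA a]; first by rewrite linear0.
  by rewrite (linearP (peval _)) /= Tp // Tq // scaler0 addr0.
move=> p q Tp; split=> A VA a; rewrite peval_mul [peval _ p]Tp //.
  by rewrite linear0l.
by rewrite linear0r.
Qed.

(** Assignments lift to polynomials; substituting these into an identity of [V] gives a polynomial
    that vanishes throughout [V]. *)
Lemma variety_one_variable_quotient : V (quot_algebra one_variable_ideal).
Proof.
have [E VE] := V_variety; apply/VE => v Ev y.
have /choice[p py] i := quot_proj_surj (y i).
have -> : y = quot_proj one_variable_ideal \o p.
  by apply/funext => i; exact/esym/py.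
rewrite -(hom_peval (quot_projM _)) -[RHS](linear0 (quot_proj _)).
apply/quot_projE; rewrite subr0 => A /VE AE a; rewrite peval_peval; exact: AE.
Qed.

(* With [g] the image of the variable in the (finite) free algebra [Q] of rank 1
   of [V], a minimal algebra of [V] with a chosen nonzero element is determined,
   up to identities, by the kernel of the corresponding map from [range (peval
   (fun=> g))] to it. *)
Lemma finite_minimal_representatives :
  exists n (a : 'I_n -> algebra F),
    (forall k, V (a k) /\ minimal_algebra (a k)) /\
    forall M, V M -> minimal_algebra M ->
      exists k, forall v, satisfies (a k) v -> satisfies M v.
Proof.
pose proj := quot_proj one_variable_ideal.
pose g := proj << Var 0 >>.
pose X0 : free_algebra F := << Var 0 >>.
have projE p : peval (fun=> g) p = proj (peval (fun=> X0) p).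
  by rewrite (hom_peval (quot_projM _)).
pose R := range (peval (fun=> g) : free_algebra F -> _).
(* For [A] in [V] this is the kernel of the map from [R] to [A] sending [g] to [a]. *)
pose D (A : algebra F) (a : A) :=
  [set q | exists2 p, peval (fun=> g) p = q & peval (fun=> a) p = 0].
have kerD (A B : algebra F) (a : A) (b : B) : V B -> D A a = D B b ->
    forall p, peval (fun=> a) p = 0 -> peval (fun=> b) p = 0.
  move=> VB Dab p ap; have : D A a (peval (fun=> g) p) by exists p.
  (* [p] and [p'] agree at [g], hence at [b] because [B] is in [V]; and [p'] vanishes at [b]. *)
  rewrite Dab => -[p' + bp']; rewrite !projE => /quot_projE /(_ B VB b).
  have bX0 q : peval (fun=> b) (peval (fun=> X0) q) = peval (fun=> b) q.
    rewrite peval_peval; congr (peval _ q).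
    by apply/funext => i /=; rewrite peval_var.
  rewrite (linearB (peval _)) /= !bX0 bp' sub0r => /eqP.
  by rewrite oppr_eq0 => /eqP.
pose good K := exists (A : algebra F) (a : A),
  [/\ V A, minimal_algebra A, a != 0 & D A a = K].
have /finite_seqP[s sE] : finite_set [set K | good K].
  have /finite_fsetP[r rE] : finite_set R.
    exact: finite_range_peval variety_one_variable_quotient.
  (* The kernels are subsets of the finite set [R], so there are finitely many of them. *)
  apply: sub_finite_set (finite_image (fun X : {fset _} => [set` X])
    (finite_fset (fpowerset r))) => K [A [a [_ _ _ DK]]].
  exists [fset q in r | `[< K q >]]%fset.
    by rewrite /= fpowersetE; apply/fsubsetP => q; rewrite !inE => /andP[].
  apply/seteqP; split=> q /=; rewrite !inE /=; first by case/andP=> _ /asboolP.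
  move=> Kq; apply/andP; split; last exact/asboolP.
  have : R q by move: Kq; rewrite -DK => -[p pq _]; exists p.
  by rewrite rE.
have /choice[A AP] (k : 'I_(size s)) : exists (A : algebra F) (a : A),
    [/\ V A, minimal_algebra A, a != 0 & D A a = nth set0 s k].
  have : [set` s] (nth set0 s k) by rewrite /= mem_nth.
  by rewrite -sE.
exists (size s), A; split=> [k|M VM Mmin]; first by have [a []] := AP k.
have [[m mn0] _] := Mmin.
have /(nthP set0)[k ltks kE] : [set` s] (D M m) by rewrite -sE; exists M, m.
have [a [VA _ _ Da]] := AP (Ordinal ltks).
exists (Ordinal ltks) => v Av x.
(* Elements of [M] are polynomials in [m], so a value of [v] on [M] is the value at [m] of a
   substituted polynomial. That polynomial vanishes at [a], where it is a value of [v] again, and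
   [kerD] transfers this to [m]. *)
have /choice[p px] i : exists p, peval (fun=> m) p = x i.
  have : [set: M] (x i) by [].
  by rewrite -(minimal_range_peval Mmin mn0) => -[p _ <-]; exists p.
have -> : x = peval (fun=> m) \o p by apply/funext => i; exact/esym/px.
rewrite -peval_peval; apply: (kerD _ _ a m VM); first by rewrite Da.
by rewrite peval_peval; exact: Av.
Qed.

Lemma retract_property_generated :
  retract_property V ->
  exists (n : nat) (a : 'I_n -> algebra F),
    (forall k, finite_algebra (a k) /\ minimal_algebra (a k)) /\
    (forall B, V B <-> generated_variety a B).
Proof.
move=> Vretract; have [n [a [Va aM]]] := finite_minimal_representatives.
exists n, a; split=> [k|B].
  have [Vak kmin] := Va k; split=> //; have [[x xn0] _] := kmin.
  rewrite /finite_algebra -(minimal_range_peval kmin xn0).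
  exact: finite_range_peval.
split=> [VB v av|aB].
  apply: minimal_identity VB => // M VM Mmin.
  by have [k] := aM M VM Mmin; apply; exact: av.
have [E VE] := V_variety; apply/VE => v Ev; apply: aB => k.
by have [/VE + _] := Va k; apply.
Qed.
End MinimalGeneration.

Theorem theorem12 (F : fieldType) (V : algebra F -> Prop)
    (V_variety : is_variety V) (V_locally_finite : locally_finite V) :
  let i := forall B : algebra F, V B -> finite_algebra B ->
    forall A : set B, subalgebra A -> finite_set A -> retract A in
  let ii := exists (n : nat) (a : 'I_n -> algebra F),
    (forall k : 'I_n, finite_algebra (a k) /\ minimal_algebra (a k)) /\
    (forall B : algebra F, V B <-> generated_variety a B) in
  let iii := forall A : algebra F, V A -> finite_algebra A -> injective_in V A
  in (i <-> ii) /\ (ii <-> iii).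
Proof.
move=> i ii iii.
have i_ii : i -> ii by exact: retract_property_generated.
have ii_i : ii -> i.
  move=> [n [a [afm VE]]] B /VE aB Bfin A Asub _.
  exact: generated_retract afm aB Bfin Asub.
have i_iii : i -> iii by exact: retract_property_injective.
have iii_i : iii -> i by exact: injective_retract_property.
by split; split=> // [/ii_i|/iii_i].
Qed.
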